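(* Let $\hbar>0$, $n\ge1$, $0<r\le1$, $1\le p_1,p_2<\infty$. Let $K:\hbar\mathbb{Z}^n\times\hbar\mathbb{Z}^n\to\mathbb{C}$ be a function such that $$\sum_{k\in\hbar\mathbb{Z}^n}\Big(\sum_{m\in\hbar\mathbb{Z}^n}|K(k,m)|^{p_2}\Big)^{r/p_2}<\infty .$$ Let $A:\ell^{p_1}(\hbar\mathbb{Z}^n)\to\ell^{p_2}(\hbar\mathbb{Z}^n)$ be the linear operator defined by $$e_m(Ae_k)=K(k,m),\qquad k,m\in\hbar\mathbb{Z}^n,$$ where $e_m$ is considered to be an element of $\ell^{p_2'}(\hbar\mathbb{Z}^n)$. Then $A$ is an $r$-nuclear operator.
   Context: $\hbar\mathbb{Z}^n=\{\hbar z:z\in\mathbb{Z}^n\}$; $\{e_k\}_{k\in\hbar\mathbb{Z}^n}$ is the standard basis, $e_k(x)=1$ if $x=k$ and $0$ otherwise; as a functional, $e_m(f)=f(m)$, so $A$ is the operator $Af=\sum_k f(k)Ae_k$, i.e. $(Af)(m)=\sum_{k}K(k,m)f(k)$. $p'$ denotes the conjugate exponent of $p$. For $0<r\le1$ and $1\le p_1,p_2<\infty$, a bounded operator $A:L^{p_1}(X_1,\mu_1)\to L^{p_2}(X_2,\mu_2)$ between $\sigma$-finite measure spaces is $r$-nuclear if there are sequences $g_m\in L^{p_2}(X_2,\mu_2)$, $h_m\in L^{p_1'}(X_1,\mu_1)$ with $(Af)(x)=\int_{X_1}\big(\sum_{m=1}^\infty g_m(x)h_m(y)\big)f(y)\,d\mu_1(y)$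 and $\sum_{m=1}^\infty\|g_m\|^r_{L^{p_2}}\|h_m\|^r_{L^{p_1'}}<\infty$. Here both spaces are $\hbar\mathbb{Z}^n$ with counting measure. *)

(* Defs.v *)
(* MathComp-Analysis over an arbitrary [R : realType]; scalars are [R[i]]. *)
From HB Require Import structures.
From mathcomp Require Import all_boot all_order all_algebra.
From mathcomp Require Import complex.
From mathcomp Require Import all_classical all_reals all_analysis.
From mathcomp.analysis Require summability.

Set Implicit Arguments.
Unset Strict Implicit.
Unset Printing Implicit Defensive.
Import Order.TTheory GRing.Theory Num.Theory.
Import numFieldNormedType.Exports.

Local Open Scope classical_set_scope.
Local Open Scope ring_scope.

Section complex_functions.
Context {R : realType} {d : measure_display} {T : measurableType d}.
Implicit Types (mu : {measure set T -> \bar R}) (f : T -> R[i]).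

(* The norm [`|z|] of [R[i]] is itself an element of [R[i]], with zero imaginary
   part. *)
Definition cabs (z : R[i]) : R := complex.Re `|z|.

Definition cmeasurable f : Prop :=
  measurable_fun [set: T] (fun x => complex.Re (f x)) /\
  measurable_fun [set: T] (fun x => complex.Im (f x)).

Definition cintegrable mu f : Prop :=
  mu.-integrable [set: T] (fun x => (complex.Re (f x))%:E) /\
  mu.-integrable [set: T] (fun x => (complex.Im (f x))%:E).

(* Meaningful only for functions satisfying [cintegrable]. *)
Definition cintegral mu f : R[i] :=
  Complex (\int[mu]_x complex.Re (f x)) (\int[mu]_x complex.Im (f x)).

(* For [p = +oo] this is the essential supremum of [|f|]. *)
Definition cLnorm mu (p : \bar R) f : \bar R :=
  Lnorm mu p (fun x => (cabs (f x))%:E).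

(* Membership in L^p, for functions rather than for classes modulo equality
   almost everywhere. *)
Definition inLp mu (p : \bar R) f : Prop :=
  cmeasurable f /\ (cLnorm mu p f < +oo)%E.

End complex_functions.

Section nuclear.
Context {R : realType} {d1 d2 : measure_display}
  {T1 : measurableType d1} {T2 : measurableType d2}.
Variables (mu1 : {sigma_finite_measure set T1 -> \bar R})
  (mu2 : {sigma_finite_measure set T2 -> \bar R}) (p1 p2 : R).
Implicit Type A : (T1 -> R[i]) -> (T2 -> R[i]).

(* [A] acts on representatives, so linearity is required almost everywhere;
   with the norm bound it makes [A] compatible with equality almost everywhere.
   Only the values of [A] on L^p1 matter. *)
Definition bounded_linear_operator A : Prop :=
  [/\ forall f, inLp mu1 p1%:E f -> inLp mu2 p2%:E (A f),
      forall (a : R[i]) f g, inLp mu1 p1%:E f -> inLp mu1 p1%:E g ->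
        {ae mu2, forall x,
          A (fun y => a * f y + g y) x = a * A f x + A g x} &
      exists C : R, forall f, inLp mu1 p1%:E f ->
        (cLnorm mu2 p2%:E (A f) <= C%:E * cLnorm mu1 p1%:E f)%E].

Definition r_nuclear (r : R) A : Prop :=
  bounded_linear_operator A /\
  exists (g : nat -> T2 -> R[i]) (h : nat -> T1 -> R[i]),
    let kernel (x : T2) (y : T1) : R[i] :=
      limn (fun N => \sum_(0 <= m < N) g m x * h m y : R[i]^o) in
    [/\ forall m, inLp mu2 p2%:E (g m),
        forall m, inLp mu1 (hoelder_conjugate p1%:E) (h m),
        (\sum_(0 <= m <oo)
           (poweR (cLnorm mu2 p2%:E (g m)) r *
            poweR (cLnorm mu1 (hoelder_conjugate p1%:E) (h m)) r) < +oo)%E &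
        forall f, inLp mu1 p1%:E f -> {ae mu2, forall x,
          cintegrable mu1 (fun y => kernel x y * f y) /\
          A f x = cintegral mu1 (fun y => kernel x y * f y)}].

End nuclear.

Section lattice.
Context {R : realType}.
Variables (hbar : R) (n : nat).

Definition in_hZ (x : 'rV[R]_n) : bool :=
  `[< exists z : 'rV[int]_n, x = hbar *: map_mx intr z >].

Definition hZ : Type := {x : 'rV[R]_n | in_hZ x}.

HB.instance Definition _ := Choice.on hZ.

Lemma in_hZ0 : in_hZ 0.
Proof. by apply/asboolP; exists 0; rewrite map_mx0 scaler0. Qed.

HB.instance Definition _ := isPointed.Build hZ (exist _ 0 in_hZ0).

HB.instance Definition _ := @isMeasurable.Build default_measure_display
  hZ discrete_measurable discrete_measurable0
  discrete_measurableC discrete_measurableU.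

(* An alias of [counting], whose own sigma-finite instance is that of [nat]. *)
Definition hZ_counting : set hZ -> \bar R := @counting hZ R.

HB.instance Definition _ := Measure.on hZ_counting.

Lemma hZ_countable : countable [set: hZ].
Proof.
have zP (x : hZ) : exists z : 'rV[int]_n, val x = hbar *: map_mx intr z.
  by case: x => x /= /asboolP.
have [z zE] := choice zP.
apply/pcard_injP; exists (fun x => pickle (z x)) => x y _ _.
by move=> /(pcan_inj pickleK) xy; apply: val_inj; rewrite !zE xy.
Qed.

Lemma sigma_finite_hZ_counting : sigma_finite [set: hZ] hZ_counting.
Proof.
have /pcard_injP[u uI] := hZ_countable.
exists (fun k => [set x | u x = k]).
  by apply/seteqP; split=> // x _; exists (u x).
move=> k; split=> //; rewrite /hZ_counting /counting asboolT ?ltry//.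
have [[x xk]|nk] := pselect (exists x, u x = k).
  apply: (sub_finite_set _ (finite_set1 x)) => y /= yk.
  by apply: uI; rewrite ?in_setT// yk.
apply: (sub_finite_set _ (finite_set0 _)) => y /= yk.
by apply: nk; exists y.
Qed.

HB.instance Definition _ :=
  @Measure_isSigmaFinite.Build _ _ _ hZ_counting sigma_finite_hZ_counting.

Definition e_ (k : hZ) : hZ -> R[i] := fun x => (x == k)%:R.

(* Unconditional sum: the limit of the finite partial sums along the filter of
   finite subsets ordered by inclusion; [R[i]^o] carries the usual topology of
   the complex numbers. *)
Definition csum (f : hZ -> R[i]) : R[i] :=
  @summability.sum hZ R[i] R[i]^o f.

End lattice.

Arguments hZ_counting {R hbar n}.

(* Main.v *)
Require Import Defs.
From HB Require Import structures.
From mathcomp Require Import all_boot all_order all_algebra.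
From mathcomp Require Import complex finmap.
From mathcomp Require Import all_classical all_reals all_analysis.
From mathcomp Require Import measurable_realfun ess_sup_inf lra.

(** Expand a function in the standard basis: [f] is the sum of the [f k] [e_k],
    so [A f] is the sum over [k] of [f k] times the column [K k] of the kernel,
    and [A] is the sum of the rank-one operators with [g] = [K k] and
    [h] = [e_k].  Since [e_k] has norm at most 1 in every [l^q] with [q >= 1],
    and since the [r]-th power of the [l^p2] norm of [K k] is the [k]-th term of
    the hypothesis, this expansion has a finite [r]-nuclear sum.

    What is left is to check that the expansion does define [A], as a bounded
    operator given by absolutely convergent integrals.

    - As [r <= 1], summability of the [r]-th powers of the norms of the columns
      gives summability of these norms themselves ([esum_poweR_lty]).  Each
      value of a function is bounded by its [l^p] norm, so for every [f] in
      [l^p1] and every [x] the function [K y x * f y] of [y] is absolutely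
      summable ([cintegrable_kernel_mul]).

    - The defining unconditional sum of [A f x] is therefore the integral of
      that function for the counting measure ([csum_cintegral]): over a finite
      set [B], the error of the partial sum of a real function is at most the
      error of the partial sum of its absolute value
      ([le_abs_fsum_integral]), and the latter tends to 0 because the integral
      of a nonnegative function is the supremum of its finite sums
      ([ge0_integral_hZ]).  Linearity of [A] is then linearity of the
      integral.

    - Boundedness is Minkowski's inequality for series ([cLnorm_esum_le]): the
      norm of [A f] is at most the sum of the [|f k|] times the norm of [K k],
      hence at most the norm of [f] times the sum of the norms of the columns.

    - To index the expansion by the natural numbers, choose an injection of the
      lattice into them and put zero terms outside its range.  In the kernel
      series at [(x, y)] only the term of index [y] survives, so its partial
      sums are eventually equal to [K y x] ([limn_kernel_expansion]). *)

Set Implicit Arguments.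
Unset Strict Implicit.
Unset Printing Implicit Defensive.
Import Order.TTheory GRing.Theory Num.Theory.
Import numFieldNormedType.Exports.

Local Open Scope classical_set_scope.
Local Open Scope ring_scope.

(** * Powers and sums of extended reals *)

Section poweR_series.
Context {R : realType}.
Local Open Scope ereal_scope.
Implicit Types (x y : \bar R) (p : R).

Lemma le_poweR x y p : (0 <= p)%R -> 0 <= x -> x <= y -> x `^ p <= y `^ p.
Proof.
move=> p0 x0 xy; apply: gt0_ler_poweR => //; rewrite in_itv/= ?leey ?andbT//.
exact: le_trans xy.
Qed.

Lemma poweRK x p : (0 < p)%R -> 0 <= x -> (x `^ p) `^ p^-1 = x.
Proof. by move=> p0 x0; rewrite -poweRrM mulfV ?gt_eqF// poweRe1. Qed.

Lemma poweRVK x p : (0 < p)%R -> 0 <= x -> (x `^ p^-1) `^ p = x.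
Proof. by move=> p0 x0; rewrite -poweRrM mulVf ?gt_eqF// poweRe1. Qed.

(** Powers are monotone with a monotone inverse, so the inequality between the
    limits comes from moving the exponent to the other side and bounding each
    [u n] separately. *)
Lemma lime_poweR_le (u : (\bar R)^nat) p : (0 < p)%R ->
  (forall n, 0 <= u n) -> nondecreasing_seq u ->
  (limn u) `^ p <= limn (fun n => u n `^ p).
Proof.
move=> p0 u0 ndu; set l := limn (fun n => u n `^ p).
have ndup : nondecreasing_seq (fun n => u n `^ p).
  by move=> m n mn; apply: le_poweR (ltW p0) (u0 m) _; exact: ndu.
have cu := ereal_nondecreasing_is_cvgn ndu.
have upl n : u n `^ p <= l.
  apply: lime_ge; first exact: ereal_nondecreasing_is_cvgn.
  by exists n => // m /= nm; exact: ndup.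
have l0 : 0 <= l by exact: le_trans (poweR_ge0 _ _) (upl 0%N).
rewrite -(poweRVK p0 l0); apply: le_poweR; rewrite ?(ltW p0)//.
  by apply: lime_ge => //; exact: nearW.
apply: lime_le => //; apply: nearW => n.
by rewrite -(poweRK p0 (u0 n)) le_poweR ?poweR_ge0// invr_ge0 ltW.
Qed.

Lemma esumZl_le (T : choiceType) (c : \bar R) (a : T -> \bar R) :
  0 <= c -> (forall k, 0 <= a k) ->
  \esum_(k in [set: T]) (c * a k) <= c * \esum_(k in [set: T]) a k.
Proof.
move=> c0 a0; apply: ge_ereal_sup => _ [X finX <-].
rewrite -ge0_mule_fsumr//; apply: lee_wpmul2l => //.
by apply: ereal_sup_ubound; exists X.
Qed.

Lemma le_term_esum (T : choiceType) (a : T -> \bar R) k :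
  (forall k, 0 <= a k) -> a k <= \esum_(k in [set: T]) a k.
Proof.
move=> a0; rewrite -(esum_set1 (a0 k)) [leLHS]esum_mkcond.
by apply: le_esum => i _; case: ifP.
Qed.

(** The inclusion of [l^r] in [l^1] for [r <= 1].  If [S] is the sum of the
    [a k `^ r], then [a k <= S `^ r^-1], so
    [a k = a k `^ (1 - r) * a k `^ r] is at most
    [S `^ ((1 - r) / r) * a k `^ r]; sum over [k]. *)
Lemma esum_poweR_lty (T : choiceType) (a : T -> \bar R) (r : R) :
  (0 < r)%R -> (r <= 1)%R -> (forall k, 0 <= a k) ->
  \esum_(k in [set: T]) (a k `^ r) < +oo -> \esum_(k in [set: T]) a k < +oo.
Proof.
move=> r0 r1 a0; set S := \esum_(k in _) _ => Soo.
have S0 : 0 <= S by apply: esum_ge0 => k _; exact: poweR_ge0.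
pose c := S `^ ((1 - r) / r).
have c0 : 0 <= c by exact: poweR_ge0.
have ac k : a k <= c * a k `^ r.
  have aS : a k `^ r <= S.
    by apply: (@le_term_esum _ (fun k => a k `^ r)) => i; exact: poweR_ge0.
  have akoo : a k < +oo.
    by rewrite -(poweRK r0 (a0 k)) poweR_lty// (le_lt_trans aS).
  have aE : a k = a k `^ ((1 - r) / r * r) * a k `^ r.
    have [->|ak0] := eqVneq (a k) 0.
      by rewrite [X in _ = _ * X]poweR0r ?gt_eqF// mule0.
    rewrite divfK ?gt_eqF// -poweRD; last first.
      by apply/nneg_neq0_poweRD_def => //; rewrite ?subr_ge0// ltW.
    by rewrite subrK poweRe1.
  rewrite [leLHS]aE; apply: lee_wpmul2r; first exact: poweR_ge0.
  rewrite mulrC poweRrM; apply: le_poweR => //; last exact: poweR_ge0.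
  by rewrite divr_ge0 ?subr_ge0// ltW.
have aco : \esum_(k in [set: T]) (c * a k `^ r) < +oo.
  apply: le_lt_trans (esumZl_le c0 _) _ => [k|]; first exact: poweR_ge0.
  by apply: lte_mul_pinfty => //; rewrite ge0_fin_numE// poweR_lty.
by apply: le_lt_trans aco; apply: le_esum.
Qed.

End poweR_series.

(** * Minkowski's inequality for series *)

Section countable_minkowski.
Context d (T : measurableType d) (R : realType).
Variable mu : {measure set T -> \bar R}.
Local Open Scope ereal_scope.

Lemma measurable_fun_poweR (f : T -> \bar R) (p : R) :
  measurable_fun [set: T] f -> measurable_fun [set: T] (fun x => f x `^ p).
Proof. by move=> mf; exact: (measurableT_comp (measurable_poweR p) mf). Qed.

Lemma le_Lnorm (f g : T -> \bar R) (p : R) : (0 < p)%R ->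
  measurable_fun [set: T] f -> measurable_fun [set: T] g ->
  (forall x, `|f x| <= `|g x|) -> Lnorm mu p%:E f <= Lnorm mu p%:E g.
Proof.
move=> p0 mf mg fg; rewrite unlock; apply: le_poweR.
- by rewrite invr_ge0 ltW.
- by apply: integral_ge0 => x _; exact: poweR_ge0.
apply: ge0_le_integral => //.
- by move=> x _; exact: poweR_ge0.
- by apply: measurable_fun_poweR; exact: measurableT_comp.
- by apply: measurable_fun_poweR; exact: measurableT_comp.
- by move=> x _; apply: le_poweR => //; exact: ltW.
Qed.

(** Minkowski's inequality passes to series of nonnegative functions by monotone
    convergence of the p-th powers of the partial sums. *)
Lemma Lnorm_nneseries_le (f : nat -> T -> R) (g : T -> R) (p : R) :
  (1 <= p)%R -> (forall n, measurable_fun [set: T] (f n)) ->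
  measurable_fun [set: T] g -> (forall n x, (0 <= f n x)%R) ->
  (forall x, `|g x|%:E <= \sum_(0 <= n <oo) (f n x)%:E) ->
  Lnorm mu p%:E (EFin \o g) <= \sum_(0 <= n <oo) Lnorm mu p%:E (EFin \o f n).
Proof.
move=> p1 mf mg f0 gf; have p0 : (0 < p)%R by exact: lt_le_trans p1.
pose s n x := (\sum_(0 <= k < n) f k x)%R.
have s0 n x : (0 <= s n x)%R by exact: sumr_ge0.
have ms n : measurable_fun [set: T] (s n) by exact: measurable_sum.
have nds x : nondecreasing_seq (fun n => (s n x)%:E).
  move=> m n mn; rewrite lee_fin /s.
  by rewrite (big_cat_nat _ mn)//= lerDl sumr_ge0.
set B := \sum_(0 <= n <oo) _.
have B0 : 0 <= B by apply: nneseries_ge0 => n _ _; exact: Lnorm_ge0.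
(* the partial sums obey the triangle inequality for two functions *)
have sB n : Lnorm mu p%:E (EFin \o s n) <= B.
  apply: (@le_trans _ _ (\sum_(0 <= k < n) Lnorm mu p%:E (EFin \o f k))).
    elim: n => [|n ih].
      rewrite big_nil (_ : EFin \o _ = cst 0) ?Lnorm0 ?eqe ?gt_eqF//.
      by apply/funext => x /=; rewrite /s big_nil.
    rewrite big_nat_recr//=.
    rewrite (_ : EFin \o s n.+1 = EFin \o (s n \+ f n)%R); last first.
      by apply/funext => x /=; rewrite /s big_nat_recr.
    by apply: le_trans (minkowski_EFin mu _ _ _) _ => //; exact: leeD.
  by apply: nneseries_lim_ge => k _ _; exact: Lnorm_ge0.
have sBp n : \int[mu]_x ((s n x)%:E `^ p) <= B `^ p.
  rewrite (eq_integral (fun x => `|(EFin \o s n) x| `^ p)).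
    rewrite -poweR_Lnorm ?gt_eqF//.
    by apply: le_poweR; rewrite ?Lnorm_ge0// ltW.
  by move=> x _ /=; rewrite ger0_norm.
have msp n : measurable_fun [set: T] (fun x => (s n x)%:E `^ p).
  by apply: measurable_fun_poweR; exact/measurable_EFinP.
have ndsp x : nondecreasing_seq (fun n => (s n x)%:E `^ p).
  move=> m n mn; apply: le_poweR; [exact: ltW|by rewrite lee_fin|exact: nds].
have cvgI := @cvg_monotone_convergence _ T R mu setT measurableT
  (fun n x => (s n x)%:E `^ p) msp (fun n x _ => poweR_ge0 _ _)
  (fun x _ => ndsp x).
rewrite unlock -(poweRK p0 B0); apply: le_poweR.
- by rewrite invr_ge0 ltW.
- by apply: integral_ge0 => x _; exact: poweR_ge0.
apply: (@le_trans _ _ (\int[mu]_x limn (fun n => (s n x)%:E `^ p))); last first.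
  rewrite -(cvg_lim _ cvgI)//; apply: lime_le; last exact: nearW.
  by apply/cvg_ex; eexists; exact: cvgI.
apply: ge0_le_integral => //.
- move=> x _; apply: poweR_ge0.
- apply: measurable_fun_poweR.
  by apply: measurableT_comp => //; exact/measurable_EFinP.
- apply: emeasurable_fun_cvg msp _ => x _; exact: ereal_nondecreasing_is_cvgn.
- move=> x _; apply: le_trans (lime_poweR_le p0 _ (nds x)); last first.
    by move=> n; rewrite lee_fin.
  apply: le_poweR => //; first exact: ltW.
  rewrite /=; apply: le_trans (gf x) _; rewrite le_eqVlt; apply/orP; left.
  apply/eqP; congr (limn _); apply/funext => n.
  by rewrite /s sumEFin.
Qed.

End countable_minkowski.

(** * Complex numbers: modulus and integral *)

Section complex_modulus.
Context {R : realType}.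
Implicit Types z w : R[i].

Lemma normc_cabs z : `|z| = (cabs z)%:C%C.
Proof. by rewrite /cabs normc_def. Qed.

Lemma cabs_ge0 z : 0 <= cabs z.
Proof. by rewrite -ler0c -normc_cabs. Qed.

Lemma cabs0 : cabs (0 : R[i]) = 0.
Proof. by rewrite /cabs normr0. Qed.

Lemma cabs1 : cabs (1 : R[i]) = 1.
Proof. by rewrite /cabs normr1. Qed.

Lemma cabsM z w : cabs (z * w) = cabs z * cabs w.
Proof. by apply: complexI; rewrite rmorphM/= -!normc_cabs normrM. Qed.

Lemma ler_cabsD z w : cabs (z + w) <= cabs z + cabs w.
Proof. by rewrite -lecR rmorphD/= -!normc_cabs ler_normD. Qed.

Lemma normr_Re_le_cabs z : `|complex.Re z| <= cabs z.
Proof. by rewrite -lecR -normc_cabs normc_ge_Re. Qed.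

Lemma normr_Im_le_cabs z : `|complex.Im z| <= cabs z.
Proof.
have := normr_Re_le_cabs (z * 'i%C).
rewrite ReiNIm normrN cabsM (_ : cabs 'i%C = 1) ?mulr1//.
by rewrite /cabs normc_def/= expr0n/= add0r expr1n sqrtr1.
Qed.

Lemma cabs_le_ReDIm z : cabs z <= `|complex.Re z| + `|complex.Im z|.
Proof.
have r x : cabs (x%:C%C : R[i]) = `|x|.
  by rewrite /cabs normc_def/= expr0n/= addr0 sqrtr_sqr.
rewrite {1}[z]complexE (le_trans (ler_cabsD _ _))// cabsM !r.
rewrite (_ : cabs 'i%C = 1) ?mul1r//.
by rewrite /cabs normc_def/= expr0n/= add0r expr1n sqrtr1.
Qed.

Lemma ReM z w : complex.Re (z * w) =
  complex.Re z * complex.Re w - complex.Im z * complex.Im w.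
Proof. by case: z w => [a b] [c e]. Qed.

Lemma ImM z w : complex.Im (z * w) =
  complex.Re z * complex.Im w + complex.Im z * complex.Re w.
Proof. by case: z w => [a b] [c e]. Qed.

Lemma ReD z w : complex.Re (z + w) = complex.Re z + complex.Re w.
Proof. by case: z w => [a b] [c e]. Qed.

Lemma ImD z w : complex.Im (z + w) = complex.Im z + complex.Im w.
Proof. by case: z w => [a b] [c e]. Qed.

Lemma Re_sum (I : Type) (s : seq I) (F : I -> R[i]) :
  complex.Re (\sum_(i <- s) F i) = \sum_(i <- s) complex.Re (F i).
Proof. exact: (big_morph _ ReD). Qed.

Lemma Im_sum (I : Type) (s : seq I) (F : I -> R[i]) :
  complex.Im (\sum_(i <- s) F i) = \sum_(i <- s) complex.Im (F i).
Proof. exact: (big_morph _ ImD). Qed.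

Lemma ReB z w : complex.Re (z - w) = complex.Re z - complex.Re w.
Proof. by case: z w => [a b] [c e]. Qed.

Lemma ImB z w : complex.Im (z - w) = complex.Im z - complex.Im w.
Proof. by case: z w => [a b] [c e]. Qed.

Lemma ler_cabs_sum (I : Type) (s : seq I) (F : I -> R[i]) :
  cabs (\sum_(i <- s) F i) <= \sum_(i <- s) cabs (F i).
Proof.
by rewrite -lecR -normc_cabs rmorph_sum/= (le_trans (ler_norm_sum _ _ _))//;
  rewrite le_eqVlt; under eq_bigr do rewrite normc_cabs; rewrite eqxx.
Qed.

End complex_modulus.

Section complex_integral.
Context d (T : measurableType d) (R : realType).
Variable mu : {measure set T -> \bar R}.
Implicit Types f g : T -> R[i].

Lemma cintegralZD (a : R[i]) f g : cintegrable mu f -> cintegrable mu g ->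
  cintegral mu (fun x => a * f x + g x) = a * cintegral mu f + cintegral mu g.
Proof.
move=> [fRe fIm] [gRe gIm].
have Zint (c : R) (u : T -> R) : mu.-integrable setT (EFin \o u) ->
    mu.-integrable setT (EFin \o (fun x => c * u x)).
  by move=> iu; exact: (integrableZl measurableT c iu).
have Dint (u v : T -> R) : mu.-integrable setT (EFin \o u) ->
    mu.-integrable setT (EFin \o v) ->
    mu.-integrable setT (EFin \o (fun x => u x + v x)).
  by move=> iu iv; exact: (integrableD measurableT iu iv).
apply/eqP; rewrite eq_complex /cintegral; apply/andP; split; apply/eqP.
  rewrite ReD ReM /=.
  under eq_Rintegral do rewrite ReD ReM -mulNr.
  by rewrite !RintegralD ?RintegralZl ?mulNr//; do ?apply: Dint; exact: Zint.
rewrite ImD ImM /=.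
under eq_Rintegral do rewrite ImD ImM.
by rewrite !RintegralD ?RintegralZl//; do ?apply: Dint; exact: Zint.
Qed.

End complex_integral.

(** * Sums over the lattice as integrals for the counting measure *)

Section lattice_integral.
Context {R : realType} (hbar : R) (n : nat).
Local Notation T := (hZ hbar n).
Local Notation mu := (@hZ_counting R hbar n).

(** Every subset of the lattice is measurable. *)
Lemma measurable_fun_hZ d (U : measurableType d) (D : set T) (f : T -> U) :
  measurable_fun D f.
Proof. by []. Qed.

Lemma cmeasurable_hZ (f : T -> R[i]) : cmeasurable f.
Proof. by split; exact: measurable_fun_hZ. Qed.

Lemma hZ_counting1 (x : T) : mu [set x] = 1%E.
Proof.
rewrite /hZ_counting /counting asboolT//.
by rewrite fset_set1 cardfs1.
Qed.

(** Cut the lattice into the fibres of an injection into the natural numbers: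
    they are empty or singletons of mass 1, and both sides are countably
    additive over them. *)
Lemma ge0_integral_hZ (f : T -> \bar R) : (forall x, (0 <= f x)%E) ->
  (\int[mu]_x f x = \esum_(x in [set: T]) f x)%E.
Proof.
move=> f0; have /pcard_injP[u uI] := hZ_countable hbar n.
pose F k : set T := [set x | u x = k].
have FT : \bigcup_k F k = [set: T].
  by apply/seteqP; split=> // x _; exists (u x).
have tF : trivIset setT F by move=> i j _ _ [x [<- <-]].
rewrite -FT ge0_integral_bigcup//.
rewrite nneseries_sum_bigcup//; apply: eq_eseriesr => k _.
have [[x xk]|nk] := pselect (exists x, u x = k).
  have -> : F k = [set x].
    apply/seteqP; split=> [y /= yk|y ->//].
    by apply: uI; rewrite ?in_setT// yk.
  rewrite esum_set1// (eq_integral (cst (f x))); last first.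
    by move=> y; rewrite inE => ->.
  by rewrite integral_cst// [X in (_ * X)%E]hZ_counting1 mule1.
have -> : F k = set0 by apply/seteqP; split=> // y yk; apply: nk; exists y.
by rewrite integral_set0 esum_set0.
Qed.

(** The partial inverse [c] of an injection [u] enumerates the lattice with
    gaps.  Series over the lattice become series over [nat] with zero terms at
    the gaps, in the same way whether the lattice is finite or infinite. *)
Lemma hZ_enumeration : exists (u : T -> nat) (c : nat -> option T),
  (forall k, c (u k) = Some k) /\ (forall m k, c m = Some k -> m = u k).
Proof.
have /pcard_injP[u uI] := hZ_countable hbar n.
exists u; have /choice[c cP] : forall m, exists o : option T,
    if o is Some k then u k = m else forall k, u k <> m.
  move=> m; have [[k km]|nk] := pselect (exists k, u k = m).
    by exists (Some k).
  by exists None => k km; apply: nk; exists k.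
exists c; split=> [k|m k cm]; last by have := cP m; rewrite cm.
have := cP (u k); case: (c (u k)) => [l|/(_ k)//].
by move=> /uI ->; rewrite ?in_setT.
Qed.

Lemma nneseries_enumeration (u : T -> nat) (c : nat -> option T)
    (F : T -> \bar R) :
  (forall k, c (u k) = Some k) -> (forall m k, c m = Some k -> m = u k) ->
  (forall k, (0 <= F k)%E) ->
  (\sum_(0 <= m <oo) (if c m is Some k then F k else 0) =
   \esum_(k in [set: T]) F k)%E.
Proof.
move=> cu uc F0; rewrite nneseries_esumT; last by move=> m; case: (c m).
transitivity (\esum_(m in u @` [set: T]) (if c m is Some k then F k else 0))%E.
  rewrite [RHS]esum_mkcond; apply: eq_esum => m _.
  case: ifPn => //; rewrite notin_setE/= => nm.
  by case cm : (c m) => [k|//]; exfalso; apply: nm; exists k;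
    rewrite -?(uc _ _ cm).
rewrite esum_image; first by apply: eq_esum => k _; rewrite cu.
by move=> k l _ _ kl; have := cu k; rewrite kl cu => -[].
Qed.

(** The functions [|f| + f] and [|f| - f] are nonnegative, so their sums over
    [B] are at most their integrals; this is the claim, split into its two signs. *)
Lemma le_abs_fsum_integral (f : T -> R) (B : {fset T}) :
  integrable mu setT (EFin \o f) ->
  `|\int[mu]_x f x - \sum_(x <- B) f x| <=
  \int[mu]_x `|f x| - \sum_(x <- B) `|f x|.
Proof.
move=> fi; have fai := integrable_norm fi.
have key (g : T -> R) : (forall x, 0 <= g x) ->
    integrable mu setT (EFin \o g) -> \sum_(x <- B) g x <= \int[mu]_x g x.
  move=> g0 gi; rewrite -lee_fin /Rintegral fineK ?integrable_fin_num//.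
  rewrite ge0_integral_hZ; last by move=> x; rewrite lee_fin.
  rewrite -sumEFin; apply: esum_ge; exists [set` B].
    by split=> //; exact: finite_fset.
  by rewrite -fsbig_seq//; exact: fset_uniq.
have keyD : \sum_(x <- B) `|f x| + \sum_(x <- B) f x <=
    \int[mu]_x `|f x| + \int[mu]_x f x.
  rewrite -RintegralD// -big_split/=; apply: key => [x|].
    by have := ler_norm (- f x); rewrite normrN; lra.
  exact: (integrableD measurableT fai fi).
have keyB : \sum_(x <- B) `|f x| - \sum_(x <- B) f x <=
    \int[mu]_x `|f x| - \int[mu]_x f x.
  rewrite -RintegralB// -sumrB/=; apply: key => [x|].
    by rewrite subr_ge0 ler_norm.
  exact: (integrableB measurableT fai fi).
move: keyD keyB; move: (\int[mu]_x `|f x|) (\int[mu]_x f x).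
move: (\sum_(x <- B) `|f x|) (\sum_(x <- B) f x) => a b c e.
by clear => keyD keyB; rewrite ler_norml; apply/andP; split; lra.
Qed.

Lemma cvg_psum_Rintegral (f : T -> R) (e : R) :
  integrable mu setT (EFin \o f) -> 0 < e ->
  \forall B \near @summability.totally T,
    `|\int[mu]_x f x - \sum_(x <- enum_fset B) f x| < e.
Proof.
move=> fi e0; have fai := integrable_norm fi.
set I := \int[mu]_x `|f x|.
have IE : I%:E = (\esum_(x in [set: T]) `|f x|%:E)%E.
  rewrite /I /Rintegral fineK ?integrable_fin_num//.
  by rewrite ge0_integral_hZ// => x; rewrite lee_fin.
have : ((I - e)%:E < \esum_(x in [set: T]) `|f x|%:E)%E.
  by rewrite -IE lte_fin; lra.
(* a finite set X that captures the integral of |f| up to e *)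
move=> /ereal_sup_gt[_ [X [finX _] <-]].
rewrite fsbig_finite//= sumEFin lte_fin => IX.
exists (fset_set X) => // B /= XB.
apply: le_lt_trans (le_abs_fsum_integral _ fi) _.
rewrite -/I ltrBlDr -ltrBlDl.
apply: lt_le_trans IX _.
rewrite [leRHS](bigID (mem (fset_set X)))/= -[in leRHS]big_filter.
rewrite [X in _ <= X + _](perm_big (fset_set X))/=.
  by rewrite lerDl sumr_ge0.
apply: uniq_perm; rewrite ?filter_uniq ?fset_uniq// => x.
by rewrite mem_filter; case: (boolP (x \in fset_set X)) => //= /(fsubsetP XB).
Qed.

Lemma cvg_psum_cintegral (f : T -> R[i]) (e : R) : cintegrable mu f -> 0 < e ->
  \forall B \near @summability.totally T,
    cabs (cintegral mu f - \sum_(x <- enum_fset B) f x) < e.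
Proof.
move=> [fRe fIm] e0; have FF := @summability.totally_filter T.
have e20 : 0 < e / 2 by rewrite divr_gt0.
near=> B.
rewrite (le_lt_trans (cabs_le_ReDIm _))// ReB ImB Re_sum Im_sum (splitr e).
by rewrite ltrD//; near: B; exact: cvg_psum_Rintegral.
Unshelve. all: by end_near.
Qed.

Lemma csum_cintegral (f : T -> R[i]) : cintegrable mu f ->
  csum f = cintegral mu f.
Proof.
move=> fi; have FF := @summability.totally_filter T.
apply: (@cvg_lim R[i]^o _ _ _ FF); first exact: norm_hausdorff.
apply/cvgrPdist_lt => e e0.
(* a positive element of R[i] is real *)
have {e0} [d d0 ->] : exists2 d : R, 0 < d & e = d%:C%C.
  move: e0; rewrite ltcE/= => /andP[/eqP e2 e1].
  by exists (complex.Re e) => //; rewrite [LHS]complexE e2 mulr0 addr0.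
near=> B.
rewrite /summability.partial_sum -(big_seq_fsetE _ B xpredT f) normc_cabs ltcR.
by near: B; exact: cvg_psum_cintegral.
Unshelve. all: by end_near.
Qed.

(** Going through finite partial sums yields the constant 1, which splitting
    into real and imaginary parts would not. *)
Lemma cabs_cintegral_le (f : T -> R[i]) : cintegrable mu f ->
  ((cabs (cintegral mu f))%:E <= \esum_(x in [set: T]) (cabs (f x))%:E)%E.
Proof.
move=> fi; apply/lee_addgt0Pr => e e0.
have FF := @summability.totally_filter T.
have [B Be] := filter_ex (cvg_psum_cintegral fi e0).
rewrite -[cintegral mu f](subrK (\sum_(x <- enum_fset B) f x)).
apply: (@le_trans _ _ (e + \sum_(x <- enum_fset B) cabs (f x))%:E).
  rewrite lee_fin (le_trans (ler_cabsD _ _))// lerD ?ler_cabs_sum//.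
  exact: ltW.
rewrite EFinD addeC leeD2r// -sumEFin; apply: esum_ge; exists [set` B].
  by split=> //; exact: finite_fset.
by rewrite -fsbig_seq//; exact: fset_uniq.
Qed.

Lemma cintegrable_hZ (f : T -> R[i]) :
  (\esum_(x in [set: T]) (cabs (f x))%:E < +oo)%E -> cintegrable mu f.
Proof.
move=> foo.
have dom (u : T -> R) : (forall x, `|u x| <= cabs (f x)) ->
    integrable mu setT (EFin \o u).
  move=> uf; apply/integrableP; split; first exact: measurable_fun_hZ.
  rewrite ge0_integral_hZ//; apply: le_lt_trans foo.
  by apply: le_esum => x _; rewrite lee_fin.
by split; apply: dom => x; [exact: normr_Re_le_cabs|exact: normr_Im_le_cabs].
Qed.

End lattice_integral.

(** * The l^p norms on the lattice *)

Section lattice_Lp.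
Context {R : realType} (hbar : R) (n : nat).
Local Notation T := (hZ hbar n).
Local Notation mu := (@hZ_counting R hbar n).
Implicit Types (f g : T -> R[i]) (p : R).

Lemma cLnorm_ge0 (q : \bar R) f : (0 <= cLnorm mu q f)%E.
Proof. exact: Lnorm_ge0. Qed.

Lemma inLp_hZ (q : \bar R) f : (cLnorm mu q f < +oo)%E -> inLp mu q f.
Proof. by move=> fq; split => //; exact: cmeasurable_hZ. Qed.

Lemma cLnorm_hZE p f : cLnorm mu p%:E f =
  poweR (\esum_(x in [set: T]) (cabs (f x) `^ p)%:E)%E p^-1.
Proof.
rewrite /cLnorm unlock; congr poweR; rewrite ge0_integral_hZ; last first.
  by move=> x; exact: poweR_ge0.
by apply: eq_esum => x _ /=; rewrite ger0_norm// cabs_ge0.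
Qed.

Lemma cabs_le_cLnorm p f x : 0 < p -> ((cabs (f x))%:E <= cLnorm mu p%:E f)%E.
Proof.
move=> p0; rewrite -[leLHS](poweRK p0) ?lee_fin ?cabs_ge0// cLnorm_hZE.
apply: le_poweR; [by rewrite invr_ge0 ltW|exact: poweR_ge0|].
by apply: (@le_term_esum _ _ (fun x => (cabs (f x) `^ p)%:E)%E) => k;
  rewrite lee_fin powR_ge0.
Qed.

Lemma cLnorm0 (q : \bar R) : q != 0%E -> cLnorm mu q (fun=> 0) = 0%E.
Proof.
by move=> q0; rewrite -(Lnorm0 mu q0); apply: eq_Lnorm => x; rewrite cabs0.
Qed.

Lemma cLnormZ p (a : R[i]) f : 0 < p ->
  (cLnorm mu p%:E (fun x => a * f x)%R = (cabs a)%:E * cLnorm mu p%:E f)%E.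
Proof.
move=> p0; have a0 := cabs_ge0 a.
rewrite /cLnorm unlock -[X in (X * _)%E](poweRK p0) ?lee_fin//.
rewrite -poweRM ?poweR_ge0//; last first.
  by apply: integral_ge0 => x _; exact: poweR_ge0.
congr poweR; rewrite poweR_EFin -ge0_integralZl_EFin//; last 2 first.
- by move=> x _; exact: poweR_ge0.
- exact: powR_ge0.
apply: eq_integral => x _.
by rewrite cabsM EFinM abseM poweRM ?abse_ge0//= ger0_norm.
Qed.

Lemma cLnormD p f g : 1 <= p ->
  (cLnorm mu p%:E (fun x => f x + g x)%R
    <= cLnorm mu p%:E f + cLnorm mu p%:E g)%E.
Proof.
move=> p1; apply: le_trans (minkowski_EFin mu _ _ p1) => //.
apply: le_Lnorm => //; first exact: lt_le_trans p1.
move=> x; rewrite /= lee_fin !ger0_norm ?addr_ge0 ?cabs_ge0//.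
exact: ler_cabsD.
Qed.

Lemma inLpZD p (a : R[i]) f g : 1 <= p -> inLp mu p%:E f -> inLp mu p%:E g ->
  inLp mu p%:E (fun x => a * f x + g x).
Proof.
move=> p1 [_ fp] [_ gp]; apply: inLp_hZ.
apply: le_lt_trans (cLnormD _ _ p1) _; apply: lte_add_pinfty => //.
rewrite cLnormZ; last exact: lt_le_trans p1.
by apply: lte_mul_pinfty; rewrite ?lee_fin ?cabs_ge0.
Qed.

Lemma cLnorm_esum_le p (F : T -> T -> R[i]) g : 1 <= p ->
  (forall x, (cabs (g x))%:E <= \esum_(k in [set: T]) (cabs (F k x))%:E)%E ->
  (cLnorm mu p%:E g <= \esum_(k in [set: T]) cLnorm mu p%:E (F k))%E.
Proof.
move=> p1 gF; have [u [c [cu uc]]] := hZ_enumeration hbar n.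
pose F' m x := if c m is Some k then cabs (F k x) else 0.
apply: (@le_trans _ _ (\sum_(0 <= m <oo) Lnorm mu p%:E (EFin \o F' m))%E).
  apply: Lnorm_nneseries_le => //.
  - by move=> m x; rewrite /F'; case: (c m) => // k; exact: cabs_ge0.
  - move=> x; rewrite ger0_norm ?cabs_ge0//; apply: le_trans (gF x) _.
    rewrite -(nneseries_enumeration cu uc); last first.
      by move=> k; rewrite lee_fin cabs_ge0.
    by rewrite le_eqVlt; apply/orP; left; apply/eqP; apply: eq_eseriesr => m _;
      rewrite /F'; case: (c m).
rewrite -(nneseries_enumeration cu uc); last by move=> k; exact: cLnorm_ge0.
rewrite le_eqVlt; apply/orP; left; apply/eqP; apply: eq_eseriesr => m _.
rewrite /F'; case: (c m) => //; apply: Lnorm0.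
by rewrite eqe gt_eqF// (lt_le_trans _ p1).
Qed.

(** The bound covers [q = +oo], where the norm is an essential supremum: this is
    the conjugate exponent of 1. *)
Lemma cLnorm_e_le1 (q : \bar R) (k : T) : (1 <= q)%E ->
  (cLnorm mu q (e_ k) <= 1)%E.
Proof.
case: q => [q|_|//]; last first.
  rewrite /cLnorm unlock; case: ifPn => // _.
  apply: ess_sup_ler => x /=.
  rewrite /e_; case: eqP => _; first by rewrite cabs1 normr1.
  by rewrite cabs0 normr0 lee_fin.
rewrite lee_fin => q1; have q0 : 0 < q by exact: lt_le_trans q1.
rewrite cLnorm_hZE (_ : esum _ _ = 1%E) ?poweR1r//.
rewrite -[RHS](@esum_set1 _ T k (fun=> 1%E)) ?lee_fin// [RHS]esum_mkcond.
apply: eq_esum => x _; rewrite /e_ in_set1; case: eqP => _.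
  by rewrite cabs1 powR1.
by rewrite cabs0 powR0// gt_eqF.
Qed.

End lattice_Lp.

(** * The operator and its nuclear expansion *)

Section kernel_operator.
Context {R : realType} (hbar : R) (n : nat).
Local Notation T := (hZ hbar n).
Local Notation mu := (@hZ_counting R hbar n).
Variables (p1 p2 : R) (K : T -> T -> R[i]).
Hypotheses (p1_ge1 : 1 <= p1) (p2_ge1 : 1 <= p2).
Hypothesis K_abs : (\esum_(k in [set: T]) cLnorm mu p2%:E (K k) < +oo)%E.

Let p1_gt0 : 0 < p1. Proof. exact: lt_le_trans p1_ge1. Qed.
Let p2_gt0 : 0 < p2. Proof. exact: lt_le_trans p2_ge1. Qed.

(** Bound [|f y|] by the norm of [f] and [|K y x|] by the norm of the column
    [K y]. *)
Lemma cintegrable_kernel_mul f x : inLp mu p1%:E f ->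
  cintegrable mu (fun y => K y x * f y).
Proof.
move=> [_ fp]; apply: cintegrable_hZ.
apply: (@le_lt_trans _ _ (cLnorm mu p1%:E f *
    \esum_(k in [set: T]) cLnorm mu p2%:E (K k))%E); last first.
  apply: lte_mul_pinfty => //; first exact: cLnorm_ge0.
  by rewrite ge0_fin_numE// cLnorm_ge0.
apply: le_trans (esumZl_le _ _) => [||k]; last 2 first.
- exact: cLnorm_ge0.
- exact: cLnorm_ge0.
apply: le_esum => y _; rewrite cabsM mulrC EFinM.
by apply: lee_pmul; rewrite ?lee_fin ?cabs_ge0//; exact: cabs_le_cLnorm.
Qed.

Variable A : (T -> R[i]) -> T -> R[i].
Hypothesis A_integral : forall f, inLp mu p1%:E f ->
  forall x, A f x = cintegral mu (fun y => K y x * f y).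

(** With [c] the norm of [f], pointwise [|A f x|] is at most the sum of the
    [|c K k x|]; then Minkowski's inequality for series applies to the functions
    [c K k]. *)
Lemma cLnorm_kernel_operator_le f : inLp mu p1%:E f ->
  (cLnorm mu p2%:E (A f) <=
   (fine (\esum_(k in [set: T]) cLnorm mu p2%:E (K k)))%:E *
   cLnorm mu p1%:E f)%E.
Proof.
move=> fLp; have [_ fp] := fLp.
have c0 := cLnorm_ge0 p1%:E f.
have cfin : cLnorm mu p1%:E f \is a fin_num by rewrite ge0_fin_numE.
set c := fine (cLnorm mu p1%:E f).
have c_ge0 : 0 <= c by exact: fine_ge0.
have cabsc : cabs (c%:C%C : R[i]) = c.
  by rewrite /cabs ger0_norm// ler0c.
rewrite fineK; last first.
  by rewrite ge0_fin_numE//; apply: esum_ge0 => k _; exact: cLnorm_ge0.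
rewrite muleC.
apply: (@le_trans _ _
    (\esum_(k in [set: T]) cLnorm mu p2%:E (fun x => c%:C%C * K k x)%R)%E).
  apply: cLnorm_esum_le => // x; rewrite A_integral//.
  apply: le_trans (cabs_cintegral_le _) _; first exact: cintegrable_kernel_mul.
  apply: le_esum => k _; rewrite !cabsM cabsc mulrC lee_fin ler_wpM2r ?cabs_ge0//.
  by rewrite -lee_fin fineK// cabs_le_cLnorm.
under eq_esum do rewrite cLnormZ// cabsc.
rewrite -[cLnorm mu p1%:E f]fineK//; apply: esumZl_le; first by rewrite lee_fin.
by move=> k; exact: cLnorm_ge0.
Qed.

Lemma kernel_operator_bounded : bounded_linear_operator mu mu p1 p2 A.
Proof.
split.
- move=> f fLp; apply: inLp_hZ.
  apply: le_lt_trans (cLnorm_kernel_operator_le fLp) _.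
  by apply: lte_mul_pinfty; rewrite ?lee_fin ?fine_ge0// ?esum_ge0//;
    [move=> k _; exact: cLnorm_ge0|case: fLp].
- move=> a f g fLp gLp; apply: aeW => x.
  rewrite !A_integral//; last exact: inLpZD.
  rewrite -cintegralZD; try exact: cintegrable_kernel_mul.
  by congr cintegral; apply/funext => y; rewrite mulrDr mulrCA.
- by eexists => f; exact: cLnorm_kernel_operator_le.
Qed.

End kernel_operator.

Section nuclear_expansion.
Context {R : realType} (hbar : R) (n : nat).
Local Notation T := (hZ hbar n).

(** At [y] only the term of index [u y] is nonzero, so the partial sums are
    constant from [N = u y + 1] on. *)
Lemma limn_kernel_expansion (u : T -> nat) (c : nat -> option T)
    (K : T -> T -> R[i]) x y :
  (forall k, c (u k) = Some k) -> (forall m k, c m = Some k -> m = u k) ->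
  limn (fun N => \sum_(0 <= m < N)
     (if c m is Some k then K k else fun=> 0) x *
     (if c m is Some k then e_ k else fun=> 0) y : R[i]^o) = K y x.
Proof.
move=> cu uc; apply: (@lim_near_cst R[i]^o); first exact: norm_hausdorff.
exists (u y).+1 => // N /= uN.
rewrite big_mkord (bigD1 (Ordinal uN))//= cu /e_ eqxx mulr1.
rewrite big1 ?addr0// => m mu; case cm : (c m) => [k|]; last by rewrite mulr0.
have [yk|] := eqVneq y k; last by rewrite mulr0.
by move: mu; rewrite -val_eqE/= (uc _ _ cm) yk eqxx.
Qed.

End nuclear_expansion.

Theorem theorem5 (R : realType) (hbar : R) (n : nat) (r p1 p2 : R)
    (K : hZ hbar n -> hZ hbar n -> R[i])
    (A : (hZ hbar n -> R[i]) -> (hZ hbar n -> R[i]))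
    (hbar_gt0 : 0 < hbar) (n_ge1 : (1 <= n)%N)
    (r_gt0 : 0 < r) (r_le1 : r <= 1)
    (p1_ge1 : 1 <= p1) (p2_ge1 : 1 <= p2)
    (K_sum : (\esum_(k in [set: hZ hbar n])
        poweR (\esum_(m in [set: hZ hbar n]) ((cabs (K k m)) `^ p2)%:E)
              (r / p2) < +oo)%E)
    (A_basis : forall k m : hZ hbar n, A (e_ k) m = K k m)
    (A_def : forall f : hZ hbar n -> R[i],
        inLp (@hZ_counting R hbar n) p1%:E f ->
        forall m : hZ hbar n, A f m = csum (fun k => f k * A (e_ k) m)) :
  r_nuclear (@hZ_counting R hbar n) (@hZ_counting R hbar n) p1 p2 r A.
Proof.
set mu := @hZ_counting R hbar n.
have K_rsum : (\esum_(k in [set: hZ hbar n])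
    poweR (cLnorm mu p2%:E (K k)) r < +oo)%E.
  rewrite (eq_esum (b := fun k => poweR (\esum_(m in [set: hZ hbar n])
    ((cabs (K k m)) `^ p2)%:E)%E (r / p2)))// => k _.
  by rewrite cLnorm_hZE -poweRrM mulrC.
have K_abs : (\esum_(k in [set: hZ hbar n]) cLnorm mu p2%:E (K k) < +oo)%E.
  by apply: esum_poweR_lty K_rsum => // k; exact: cLnorm_ge0.
have K_integrable := cintegrable_kernel_mul p1_ge1 p2_ge1 K_abs.
have A_integral f : inLp mu p1%:E f ->
    forall x, A f x = cintegral mu (fun y => K y x * f y).
  move=> fLp x; rewrite A_def// -csum_cintegral; last exact: K_integrable.
  by congr csum; apply/funext => k; rewrite A_basis mulrC.
split; first exact: kernel_operator_bounded A_integral.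
(* the exponent conjugate to p1, equal to +oo when p1 = 1 *)
have q_ge1 := hoelder_conj_ge1 (p := p1%:E) p1_ge1.
set q := hoelder_conjugate _ in q_ge1 *.
have q_neq0 : q != 0%E by rewrite gt_eqF// (lt_le_trans _ q_ge1).
have p2_neq0 : p2%:E != 0%E by rewrite eqe gt_eqF// (lt_le_trans _ p2_ge1).
have [u [c [cu uc]]] := hZ_enumeration hbar n.
exists (fun m => if c m is Some k then K k else fun=> 0).
exists (fun m => if c m is Some k then e_ k else fun=> 0).
split.
- move=> m; apply: inLp_hZ; case: (c m) => [k|]; last by rewrite cLnorm0// ltry.
  apply: le_lt_trans K_abs.
  apply: (@le_term_esum _ _ (fun k => cLnorm mu p2%:E (K k))).
  by move=> j; exact: cLnorm_ge0.
- move=> m; apply: inLp_hZ; case: (c m) => [k|]; last by rewrite cLnorm0// ltry.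
  by apply: le_lt_trans (cLnorm_e_le1 _ q_ge1) _; rewrite ltry.
- apply: le_lt_trans K_rsum.
  rewrite -(nneseries_enumeration cu uc); last by move=> k; exact: poweR_ge0.
  apply: lee_nneseries => m _; first by rewrite mule_ge0 ?poweR_ge0.
  case: (c m) => [k|]; last by rewrite cLnorm0// poweR0r ?gt_eqF// mul0e.
  rewrite -[leRHS]mule1; apply: lee_pmul; rewrite ?poweR_ge0//.
  rewrite -[leRHS](poweR1r r); apply: le_poweR; [exact: ltW|exact: cLnorm_ge0|].
  exact: cLnorm_e_le1.
- move=> f fLp; apply: aeW => x; rewrite A_integral//.
  split; last first.
    by congr cintegral; apply/funext => y; rewrite (limn_kernel_expansion _ _ _ cu uc).
  under eq_fun do rewrite (limn_kernel_expansion _ _ _ cu uc).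
  exact: K_integrable.
Qed.
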